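(* Let $\mathbb{F}$ be a perfect field of characteristic $2$ that is not quadratically closed, with $|\mathbb{F}|>2$. Let $n\geq 1$ be an integer. Then the greatest possible dimension for a weakly triangularizable linear subspace of $\mathrm{M}_n(\mathbb{F})$ is $\frac{n(n+1)}{2}$.
   Context: $\mathrm{M}_n(\mathbb{F})$ denotes the algebra of all $n\times n$ matrices over $\mathbb{F}$. A field $\mathbb{F}$ is called quadratically closed when it has no algebraic extension of degree $2$, i.e. every polynomial of degree $2$ with coefficients in $\mathbb{F}$ has a root in $\mathbb{F}$. A matrix is triangularizable over $\mathbb{F}$ when it is similar over $\mathbb{F}$ to an upper-triangular matrix with entries in $\mathbb{F}$ (equivalently, its characteristic polynomial splits over $\mathbb{F}$). A subset of $\mathrm{M}_n(\mathbb{F})$ is weakly triangularizable when each of its elements is triangularizable over $\mathbb{F}$ (no simultaneous triangularization is required). *)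

(* Defs.v *)
From mathcomp Require Import all_boot all_order all_algebra all_field.

Set Implicit Arguments.
Unset Strict Implicit.
Unset Printing Implicit Defensive.

Import GRing.Theory.
Local Open Scope ring_scope.

Definition perfect_field (F : fieldType) : Prop :=
  forall p : {poly F}, irreducible_poly p -> separable_poly p.

Definition quadratically_closed (F : fieldType) : Prop :=
  forall p : {poly F}, size p = 3%N -> exists x : F, root p x.

(* The library's [is_trig_mx] and [trigonalizable] refer to lower-triangular
   matrices, hence the transpose. *)
Definition is_upper_trig_mx (F : fieldType) (n : nat) (A : 'M[F]_n) : bool :=
  is_trig_mx A^T.

Definition triangularizable (F : fieldType) (n : nat) (A : 'M[F]_n) : Prop :=
  similar_in_to unitmx A (@is_upper_trig_mx F n).

Definition weakly_triangularizable (F : fieldType) (n : nat)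
    (V : {vspace 'M[F]_n}) : Prop :=
  forall A : 'M[F]_n, A \in V -> triangularizable A.

(* Main.v *)
(* Upper bound, by strong induction on n.  For a subspace P of F^n with
   0 < dim P < n, restricting to the elements of V that stabilize P and looking
   at their actions on P and on F^n/P shows that, if dim V > n(n+1)/2, then V
   contains a nonzero M with Im M <= P <= Ker M.  With P a line, every vector x
   is the image of a rank one nilpotent x f_x of V.

   Since F is perfect but has a rootless quadratic, some X^3 - X - e with e != 0
   does not split, so it cannot occur in the characteristic polynomial of a
   combination of rank one nilpotents of V.  Apply this to x f_x, y f_y and
   z f_z, where f_x(y) and f_y(x) are nonzero, and to a nonzero
   M = x u + y v of V with Im M <= P <= Ker M, P = <x, y>: every z satisfies
   f_z(y) u(z) = 0 and f_z(x) v(z) = 0.  So f_z(y) = 0 for all z outside a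
   hyperplane, or f_z(x) = 0 for all z outside a hyperplane.

   On the grid G^n, where G consists of three nonzero scalars, a hyperplane
   contains at most a third of the points.  So in the directed graph of the
   relation f_x(y) != 0 all out-degrees are at least 2N/3, where N = 3^n, while
   each 2-cycle has a vertex of in-degree at most N/3; counting arcs excludes
   this. *)

Require Import Defs.
From HB Require Import structures.
From Stdlib Require Import Classical.
From mathcomp Require Import all_boot all_order all_algebra all_field.
From mathcomp Require Import ring zify.

Set Implicit Arguments.
Unset Strict Implicit.
Unset Printing Implicit Defensive.

Import GRing.Theory.
Local Open Scope ring_scope.

(** * Split polynomials and characteristic polynomials of products *)

Definition poly_splits (F : fieldType) (p : {poly F}) : Prop :=
  exists rs : seq F, p = \prod_(z <- rs) ('X - z%:P).

Lemma poly_splits_mull (F : fieldType) (p q : {poly F}) :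
  p \is monic -> poly_splits (p * q) -> poly_splits p.
Proof.
move=> mp [rs def_pq].
have : p %| \prod_(z <- rs) ('X - z%:P) by rewrite -def_pq dvdp_mulr.
move=> /dvdp_prod_XsubC[m eqp_m]; exists (mask m rs).
by apply/eqP; rewrite -eqp_monic ?monic_prod_XsubC.
Qed.

Lemma poly_splits_mulr (F : fieldType) (p q : {poly F}) :
  q \is monic -> poly_splits (p * q) -> poly_splits q.
Proof. by rewrite mulrC; apply: poly_splits_mull. Qed.

Lemma poly_splits_mul (F : fieldType) (p q : {poly F}) :
  poly_splits p -> poly_splits q -> poly_splits (p * q).
Proof. by move=> [r ->] [s ->]; exists (r ++ s); rewrite big_cat. Qed.

Lemma poly_splits_Xn (F : fieldType) k : poly_splits ('X^k : {poly F}).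
Proof.
exists (nseq k 0); elim: k => [|k IHk] /=; first by rewrite big_nil expr0.
by rewrite big_cons -IHk subr0 exprS.
Qed.

Lemma poly_splits_root (F : fieldType) (p : {poly F}) :
  (1 < size p)%N -> poly_splits p -> exists x, root p x.
Proof.
move=> sp [[|z rs] def_p].
  by rewrite def_p big_nil size_poly1 in sp.
by exists z; rewrite def_p big_cons rootM root_XsubC eqxx.
Qed.

Lemma size_quadratic (F : fieldType) (b c : F) :
  let q := 'X^2 - b%:P * 'X + c%:P in size q = 3%N /\ q \is monic.
Proof.
move=> q; have szq : size q = 3%N.
  rewrite /q -addrA size_polyDl ?size_polyXn //.
  rewrite (leq_ltn_trans (size_polyD _ _)) // gtn_max size_polyN.
  rewrite mul_polyC (leq_ltn_trans (size_scale_leq _ _)) ?size_polyX //.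
  by rewrite (leq_ltn_trans (size_polyC_leq1 _)).
split=> //; rewrite monicE lead_coefE szq /q /= !coefD coefN coefXn coefCM.
by rewrite coefX coefC /= mulr0 subr0 addr0.
Qed.

Lemma quadratic_not_split (F : fieldType) (b c : F) :
  (forall x, x ^+ 2 - b * x + c != 0) ->
  ~ poly_splits ('X^2 - b%:P * 'X + c%:P).
Proof.
move=> no_root /poly_splits_root; have [-> _] := size_quadratic b c.
move=> /(_ isT)[x]; rewrite /root !hornerE => /eqP qx.
by case/eqP: (no_root x).
Qed.

(* Both sides are determinants of the block matrix [[X, C], [R, 1]], up to a
   power of X. *)
Lemma char_poly_mulC (F : fieldType) (n k : nat) (C : 'M[F]_(n, k))
    (R : 'M[F]_(k, n)) :
  char_poly (C *m R) * 'X^k = char_poly (R *m C) * 'X^n.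
Proof.
pose Cp := map_mx (@polyC F) C; pose Rp := map_mx (@polyC F) R.
have E1 : block_mx 'X%:M Cp Rp 1%:M *m block_mx 1%:M 0 (- Rp) 1%:M
        = block_mx (char_poly_mx (C *m R)) Cp 0 1%:M.
  rewrite mulmx_block !mulmx1 !mulmx0 !add0r mul1mx subrr mulmxN.
  by rewrite /char_poly_mx map_mxM.
have E2 : block_mx 1%:M 0 (- Rp) 'X%:M *m block_mx 'X%:M Cp Rp 1%:M
        = block_mx 'X%:M Cp 0 (char_poly_mx (R *m C)).
  rewrite mulmx_block !mul1mx !mul0mx !addr0 mulmx1 mulNmx.
  rewrite mul_mx_scalar mul_scalar_mx addNr mulNmx addrC.
  by rewrite /char_poly_mx map_mxM.
have := congr1 determinant E1; have := congr1 determinant E2.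
rewrite !det_mulmx !det_ublock !det_lblock !det1 !det_scalar !mul1r !mulr1.
rewrite /char_poly => E3 E4; rewrite -E4 mulrC E3 mulrC.
by [].
Qed.

(** * Quadratics over a perfect field of characteristic 2 *)

Section QuadraticExtension.

Variable F : fieldType.
Hypotheses (char2 : 2%N \in [pchar F]) (perfF : perfect_field F).

(** In characteristic 2 the derivative of X^2 - c is zero, so this polynomial is inseparable, hence
    reducible. *)
Lemma perfect_pchar2_sqrt (c : F) : exists x, x ^+ 2 = c.
Proof.
apply: NNPP => no_root; have szp : size ('X^2 - c%:P : {poly F}) = 3%N.
  by rewrite size_XnsubC.
have /perfF : irreducible_poly ('X^2 - c%:P : {poly F}).
  apply: cubic_irreducible => [|x]; first by rewrite szp.
  apply/negP; rewrite /root !hornerE subr_eq0 => /eqP xx.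
  by apply: no_root; exists x.
rewrite separable_poly.unlock derivB derivXn derivC subr0 -mulr_natr.
rewrite -polyC_natr (pcharf0 char2) polyC0 mulr0 coprimep0 -size_poly_eq1 szp.
by [].
Qed.

(** A rootless quadratic has a nonzero linear coefficient, since square roots exist; rescaling the
    variable then brings it to Artin-Schreier form. *)
Lemma artin_schreier_nonvalue :
  ~ quadratically_closed F -> exists d : F, forall x, x ^+ 2 + x != d.
Proof.
move=> nqc; have [p np] := not_all_ex_not _ _ nqc.
have [szp no_root] := imply_to_and _ _ np.
have def_p (x : F) : p.[x] = p`_0 + p`_1 * x + p`_2 * x ^+ 2.
  rewrite horner_coef szp !big_ord_recl big_ord0 /= /bump /=.
  by rewrite expr0 mulr1 addr0 addrA expr1.
have a0 : p`_2 != 0.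
  have := lead_coefE p; rewrite szp /= => <-.
  by rewrite lead_coef_eq0 -size_poly_eq0 szp.
have nroot x : p.[x] != 0 by apply/negP => px; apply: no_root; exists x.
have b0 : p`_1 != 0.
  apply/negP=> /eqP b0; have [x xx] := perfect_pchar2_sqrt (- (p`_0 / p`_2)).
  have := nroot x; rewrite def_p b0 xx mul0r addr0 mulrN mulrCA divff //.
  by rewrite mulr1 subrr eqxx.
exists (- (p`_0 * p`_2 / p`_1 ^+ 2)) => x; apply/negP => /eqP xx.
have := nroot (p`_1 / p`_2 * x); rewrite def_p.
have -> : p`_0 + p`_1 * (p`_1 / p`_2 * x) + p`_2 * (p`_1 / p`_2 * x) ^+ 2
   = p`_0 + p`_1 ^+ 2 / p`_2 * (x ^+ 2 + x) by field.
rewrite xx; have -> : p`_0 + p`_1 ^+ 2 / p`_2 * (- (p`_0 * p`_2 / p`_1 ^+ 2)) = 0.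
  by field; rewrite a0 b0.
by rewrite eqxx.
Qed.

(* With [1 + 1/r = d] outside the image of [x^2 + x], a root [x] of the
   quadratic would give [(x/r)^2 + x/r = d^2], and [d^2] is congruent to [d]
   modulo that image. *)
Lemma rootless_quadratic (t : F) :
  ~ quadratically_closed F -> t != 0 -> t != 1 ->
  exists r : F, [/\ r != 0, r ^+ 2 != 1
    & forall x, x ^+ 2 - r * x + (r ^+ 2 - 1) != 0].
Proof.
move=> nqc t0 t1.
have two0 : 2%:R = 0 :> F := pcharf0 char2.
(* If d = 1, adding t^2 + t moves it away from 1 within its class modulo the additive map x^2 + x.
   Then d != 1 makes r well defined, and d != 0 gives r^2 != 1. *)
have [d [d1 nd]] : exists d : F, d != 1 /\ forall x, x ^+ 2 + x != d.
  have [d nd] := artin_schreier_nonvalue nqc.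
  have [d1|] := eqVneq d 1; last by exists d.
  exists (1 + (t ^+ 2 + t)); split=> [|x].
    rewrite -subr_eq0 addrAC subrr add0r -[t in _ + t]mulr1 expr2 -mulrDr.
    by rewrite mulf_neq0 // addr_eq0 (oppr_pchar2 char2).
  apply/eqP => xx; case/eqP: (nd (x + t)); rewrite d1.
  have -> : (x + t) ^+ 2 + (x + t) =
      (x ^+ 2 + x) - (1 + (t ^+ 2 + t)) + 1 + 2%:R * (x * t + t ^+ 2 + t) by ring.
  by rewrite xx subrr add0r two0 mul0r addr0.
have d0 : d != 0.
  by apply/eqP => d0; case/eqP: (nd 0); rewrite d0 expr0n addr0.
have d10 : 1 + d != 0 by rewrite addr_eq0 (oppr_pchar2 char2) eq_sym.
pose r := (1 + d)^-1; have r0 : r != 0 by rewrite invr_eq0.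
have dE : d = 1 + r^-1.
  by rewrite /r invrK addrA (addrr_pchar2 char2) add0r.
exists r; split=> //.
  rewrite sqrf_eq1 (oppr_pchar2 char2) orbb /r invr_eq1.
  by rewrite -subr_eq0 addrAC subrr add0r.
move=> x; apply/eqP => xx; case/eqP: (nd (x / r + d)).
have -> : (x / r + d) ^+ 2 + (x / r + d) = d +
    r^-1 ^+ 2 * (x ^+ 2 - r * x + (r ^+ 2 - 1))
    + 2%:R * (x / r * (1 + d) + r^-1 + r^-1 ^+ 2).
  by rewrite dE; field.
by rewrite xx two0 mulr0 mul0r !addr0.
Qed.

End QuadraticExtension.

(** * Sums of three rank one matrices *)

Lemma char_poly_diag0_3 (F : fieldType) (f : nat -> nat -> F) :
  (forall i, f i i = 0) ->
  char_poly (\matrix_(i < 3, j < 3) f i j) = 'X^3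
    - (f 0%N 1%N * f 1%N 0%N + f 0%N 2%N * f 2%N 0%N + f 1%N 2%N * f 2%N 1%N)%:P * 'X
    - (f 0%N 1%N * f 1%N 2%N * f 2%N 0%N + f 0%N 2%N * f 1%N 0%N * f 2%N 1%N)%:P.
Proof.
move=> f0; rewrite /char_poly.
rewrite (expand_det_row _ ord0) !big_ord_recl big_ord0 /cofactor.
rewrite !(expand_det_row _ ord0) !big_ord_recl !big_ord0 /cofactor !det_mx11.
rewrite !mxE /= /bump /= !f0.
rewrite !(polyCD, polyCM, polyC0) !mulr1n !mulr0n.
by rewrite ?addn0 ?add0n ?addn1 /=; ring.
Qed.

(** Rows serve as linear forms: this is f(x), also the trace of [x *m f], so it vanishes exactly
    when that matrix is nilpotent. *)
Definition pairing (F : fieldType) n (f : 'rV[F]_n) (x : 'cV[F]_n) : F :=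
  (f *m x) 0 0.

Lemma pairingD (F : fieldType) n (f g : 'rV[F]_n) x :
  pairing (f + g) x = pairing f x + pairing g x.
Proof. by rewrite /pairing mulmxDl mxE. Qed.

Lemma pairingZ (F : fieldType) n c (f : 'rV[F]_n) x :
  pairing (c *: f) x = c * pairing f x.
Proof. by rewrite /pairing -scalemxAl mxE. Qed.

(** The sum is a product with inner dimension 3, so up to powers of X its characteristic polynomial
    is that of the 3 x 3 matrix of pairings, whose diagonal is zero. *)
Lemma char_poly_three_terms (F : fieldType) n (x y z : 'cV[F]_n) (f g h : 'rV_n) :
  pairing f x = 0 -> pairing g y = 0 -> pairing h z = 0 ->
  char_poly (x *m f + y *m g + z *m h) * 'X^3 =
  ('X^3 - (pairing f y * pairing g x + pairing f z * pairing h x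
             + pairing g z * pairing h y)%:P * 'X
     - (pairing f y * pairing g z * pairing h x
             + pairing f z * pairing g x * pairing h y)%:P) * 'X^n.
Proof.
move=> fx gy hz.
pose C := \matrix_(i < n, j < 3) nth 0 [:: x; y; z] j i 0.
pose R := \matrix_(i < 3, j < n) nth 0 [:: f; g; h] i 0 j.
have -> : x *m f + y *m g + z *m h = C *m R.
  apply/matrixP => i j; rewrite !mxE !big_ord_recl !big_ord0 !mxE /=.
  by rewrite !addr0 addrA.
rewrite char_poly_mulC.
pose G (i j : nat) : F := if (i == j) then 0 else
  pairing (nth 0 [:: f; g; h] i) (nth 0 [:: x; y; z] j).
have -> : R *m C = \matrix_(i < 3, j < 3) G i j.
  apply/matrixP => i j.
  have -> : (R *m C) i j =
     pairing (nth 0 [:: f; g; h] i) (nth 0 [:: x; y; z] j).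
    by rewrite /pairing !mxE; apply: eq_bigr => k _; rewrite !mxE.
  rewrite mxE /G; case: (eqVneq (val i) (val j)) => //= ->.
  by case: j => [[|[|[|]]]].
by rewrite char_poly_diag0_3 // => i; rewrite /G eqxx.
Qed.

Definition weakly_split (F : fieldType) n (V : {vspace 'M[F]_n}) : Prop :=
  forall A, A \in V -> poly_splits (char_poly A).

(** * Obstructions from rank one nilpotents *)

Section RankOneNilpotents.

Variables (F : fieldType) (r : F) (n : nat) (V : {vspace 'M[F]_n}).
Hypothesis no_root : forall x, x ^+ 2 - r * x + (r ^+ 2 - 1) != 0.
Hypothesis splitV : weakly_split V.

Let q : {poly F} := 'X^2 - r%:P * 'X + (r ^+ 2 - 1)%:P.

(** Otherwise, up to powers of X, the characteristic polynomial would be X^3 - X - (r - r^3) = (X +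
    r) q, and q has no root. *)
Lemma cubic_obstruction (x y z : 'cV[F]_n) (f g h : 'rV_n) :
  x *m f + y *m g + z *m h \in V ->
  pairing f x = 0 -> pairing g y = 0 -> pairing h z = 0 ->
  pairing f y * pairing g x + pairing f z * pairing h x
             + pairing g z * pairing h y = 1 ->
  pairing f y * pairing g z * pairing h x
             + pairing f z * pairing g x * pairing h y != r - r ^+ 3.
Proof.
move=> inV fx gy hz e2; apply/eqP => e3.
have := char_poly_three_terms fx gy hz; rewrite e2 e3 => Echar.
have split3 : poly_splits ((('X + r%:P) * q) * 'X^n).
  have -> : ('X + r%:P) * q * 'X^n = ('X^3 - 1%:P * 'X - (r - r ^+ 3)%:P) * 'X^n.
    rewrite /q !(polyCB, polyCD, polyCM, polyC_exp, polyC1); congr (_ * _); ring.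
  by rewrite -Echar; apply: poly_splits_mul (splitV inV) (poly_splits_Xn _ _).
have mq : q \is monic by case: (size_quadratic r (r ^+ 2 - 1)).
have mXr : 'X + r%:P \is @monic F by rewrite -[r]opprK polyCN monicXsubC.
have /poly_splits_mull := split3; rewrite monicMl // => /(_ mq).
by move/(poly_splits_mulr mq)/quadratic_not_split; apply.
Qed.

Definition rank_one_nilpotent (x : 'cV[F]_n) (f : 'rV[F]_n) : Prop :=
  (x *m f \in V) /\ (pairing f x = 0).

Variable t : F.
Hypotheses (t0 : t != 0) (t1 : t != 1).
Hypothesis squares : forall c : F, exists u, u ^+ 2 = c.
Hypotheses (r0 : r != 0) (r1 : r ^+ 2 != 1).

Lemma exists_avoid (c : F) : exists2 b : F, b != 0 & b != c.
Proof.
have [->|c1] := eqVneq c 1; last by exists 1; rewrite ?oner_eq0 // eq_sym.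
by exists t.
Qed.

Let e0 : r - r ^+ 3 != 0.
Proof.
have -> : r - r ^+ 3 = r * (1 - r ^+ 2) by ring.
by rewrite mulf_neq0 // subr_eq0 eq_sym.
Qed.

(** If p and q' are nonzero, the square root gives weights with p b2 + q' b1 = 0 and b1 b2 = c.
    Otherwise the equation is linear in one weight. *)
Lemma weights_exist (p q' c : F) : c != 0 -> (exists u, u ^+ 2 = - (p * q' * c)) ->
  exists b1 b2, b1 * b2 * (1 - p * b2 - q' * b1) = c.
Proof.
move=> c0 [u uu].
have [p0|p0] := eqVneq p 0.
  have [b b0 bq] : exists2 b : F, b != 0 & 1 - q' * b != 0.
    have [q0|q0] := eqVneq q' 0.
      by exists 1; rewrite ?q0 ?mul0r ?subr0 ?oner_neq0.
    have [b b0 bq] := exists_avoid q'^-1; exists b => //.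
    rewrite subr_eq0; apply: contraNneq bq => E.
    by apply/eqP; apply: (mulfI q0); rewrite -E divff.
  by exists b, (c / (b * (1 - q' * b))); rewrite p0; field; rewrite bq b0.
have [q0|q0] := eqVneq q' 0.
  have [b b0 bq] := exists_avoid p^-1.
  have bp : 1 - p * b != 0.
    rewrite subr_eq0; apply: contraNneq bq => E.
    by apply/eqP; apply: (mulfI p0); rewrite -E divff.
  by exists (c / (b * (1 - p * b))), b; rewrite q0; field; rewrite bp b0.
exists (u / q'), (- u / p).
transitivity (- u ^+ 2 / (p * q')); first by field; rewrite p0 q0.
by rewrite uu; field; rewrite p0 q0.
Qed.

Lemma triple_identity x y z f g h :
  rank_one_nilpotent x f -> rank_one_nilpotent y g -> rank_one_nilpotent z h ->
  pairing f y = 1 -> pairing g x = 1 ->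
  pairing g z * pairing h x + pairing f z * pairing h y = 0.
Proof.
move=> [xf fx] [yg gy] [zh hz] fy gx; apply/eqP/negPn/negP => T0.
set T := _ + _ in T0; pose k := (r - r ^+ 3) / T.
have k0 : k != 0 by rewrite mulf_neq0 // invr_eq0.
have [//||b1 [b2 Eb]] :=
  @weights_exist (pairing f z * pairing h x) (pairing g z * pairing h y) (k ^+ 2).
- by rewrite expf_neq0.
- exact: squares.
set b3 := (1 - _ - _) in Eb.
(* With these scalars the first condition of [cubic_obstruction] becomes b1 b2 b3 = k^2, and the
   cubic term becomes k T = r - r^3. *)
pose a := b2 * b3 / k; pose b := b1 * b3 / k; pose c := b1 * b2 / k.
have inV : x *m (a *: f) + y *m (b *: g) + z *m (c *: h) \in V.
  by rewrite -!scalemxAr !rpredD // rpredZ.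
have := cubic_obstruction inV; rewrite !pairingZ fx gy hz !mulr0.
rewrite fy gx => /(_ erefl erefl erefl _)/eqP; apply.
  transitivity (b1 * b2 * b3 * (b3 + pairing f z * pairing h x * b2
                  + pairing g z * pairing h y * b1) / k ^+ 2).
    by rewrite /a /b /c; field.
  by rewrite Eb /b3; field.
transitivity ((b1 * b2 * b3) ^+ 2 / k ^+ 3 * T).
  by rewrite /a /b /c /T; field.
by rewrite Eb -exprM; transitivity (k * T); [field | rewrite /k; field].
Qed.

Lemma plane_identity x y z f g h u v :
  rank_one_nilpotent x f -> rank_one_nilpotent y g -> rank_one_nilpotent z h ->
  pairing f y = 1 -> pairing g x = 1 ->
  x *m u + y *m v \in V ->
  pairing u x = 0 -> pairing u y = 0 -> pairing v x = 0 -> pairing v y = 0 ->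
  pairing h y * pairing u z = 0.
Proof.
move=> Rxf Ryg Rzh fy gx uvV ux uy vx vy.
have := triple_identity Rxf Ryg Rzh fy gx.
case: Rxf Ryg Rzh => [xf fx] [yg gy] [zh hz] E.
apply/eqP/negPn/negP; rewrite mulf_eq0 negb_or => /andP[hy0 uz0].
set X := pairing h x in E; set Y := pairing h y in E hy0.
set b0 := pairing u z in uz0; set G := pairing g z in E.
have fzE : pairing f z = - G * X / Y.
  by apply: (mulIf hy0); rewrite mulfVK // mulNr; apply/eqP; rewrite -addr_eq0 addrC E.
(* The multiple s / c of [x *m u + y *m v] makes its cross terms with c h independent of c; by
   [triple_identity], c also cancels from the cubic term. *)
have main (a b c s : F) (c0 : c != 0) :
  a * b + c * (G / Y) * (b * Y ^+ 2 - a * X ^+ 2)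
    + s * (X * b0 + Y * pairing v z) = 1 ->
  s * (b * Y * b0 + a * X * pairing v z) != r - r ^+ 3.
  move=> e2.
  have inV : x *m (a *: f + (s / c) *: u) + y *m (b *: g + (s / c) *: v)
      + z *m (c *: h) \in V.
    have -> : x *m (a *: f + (s / c) *: u) + y *m (b *: g + (s / c) *: v)
        = a *: (x *m f) + b *: (y *m g) + (s / c) *: (x *m u + y *m v).
      by rewrite !mulmxDr scalerDr -!scalemxAr addrACA.
    by rewrite -scalemxAr !rpredD ?rpredZ.
  have := cubic_obstruction inV.
  rewrite !(pairingZ, pairingD) fx gy hz ux uy vx vy !mulr0 !addr0.
  rewrite fy gx -/X -/Y -/b0 -/G fzE => /(_ erefl erefl erefl)/(_ _).
  have -> : s * (b * Y * b0 + a * X * pairing v z) = 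
     a * 1 * (b * G + s / c * pairing v z) * (c * X)
     + (a * (- G * X / Y) + s / c * b0) * (b * 1) * (c * Y).
    by field; rewrite c0 hy0.
  by apply; rewrite -[RHS]e2; field; rewrite c0 hy0.
set m := pairing v z in main.
(* If X = 0, the second equation does not involve a, which solves the first. *)
have [X0|X0] := eqVneq X 0.
  pose s := (r - r ^+ 3) / (Y * b0).
  refine (elimN eqP (main (1 - G * Y - s * (Y * m)) 1 1 s (oner_neq0 _) _) _).
    by rewrite X0; field.
  by rewrite X0 /s; field; rewrite hy0 uz0.
have [w0|w0] := eqVneq (X * b0 + Y * m) 0; last first.
  (* b Y^2 = a X^2 kills the terms in c, and then X^3 - X - (r - r^3) appears as
     X^3 - (B^2 + s w) X - s w B with B = r and s w = 1 - r^2. *)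
  refine (elimN eqP (main (r * Y / X) (r * X / Y) 1
               ((1 - r ^+ 2) / (X * b0 + Y * m)) (oner_neq0 _) _) _).
    by field; rewrite w0 X0 hy0.
  by field; rewrite w0 X0 hy0.
have mE : m = - (X * b0 / Y).
  apply: (mulIf hy0); rewrite mulNr mulfVK //; apply/eqP.
  by rewrite -addr_eq0 addrC [m * _]mulrC w0.
(* Now s is absent from the first equation and solves the second. For G != 0, taking a = 0 reduces
   the first to c G Y = 1. *)
have [G0|G0] := eqVneq G 0; last first.
  have cY0 : (G * Y)^-1 != 0 by rewrite invr_eq0 mulf_neq0.
  refine (elimN eqP (main 0 1 _ ((r - r ^+ 3) / (b0 * Y)) cY0 _) _).
    by rewrite w0; field; rewrite ?G0 ?hy0 ?uz0.
  by field; rewrite ?hy0 ?uz0.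
(* With G = 0 the first equation is a b = 1, and the second is solvable in s once a^2 differs from
   (Y / X)^2. *)
have [d d0 dXY] := exists_avoid ((Y / X) ^+ 2); have [a aa] := squares d.
have a0 : a != 0 by apply: contraNneq d0 => a0; rewrite -aa a0 expr0n.
have D0 : Y ^+ 2 - a ^+ 2 * X ^+ 2 != 0.
  rewrite aa subr_eq0; apply: contraNneq dXY => YX.
  by rewrite expr_div_n YX mulfK // expf_neq0.
pose s := (r - r ^+ 3) * a * Y / (b0 * (Y ^+ 2 - a ^+ 2 * X ^+ 2)).
refine (elimN eqP (main a a^-1 1 s (oner_neq0 _) _) _).
by rewrite w0 G0 mulr0 divff ?a0 // mul0r mulr0 mul0r !addr0.
by rewrite mE /s; field; rewrite exprMn D0 uz0 hy0 a0.
Qed.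

End RankOneNilpotents.

(** * Restriction to the stabilizer of a subspace *)

Lemma char_poly_conj (F : fieldType) n (g A : 'M[F]_n) :
  g \in unitmx -> char_poly (invmx g *m A *m g) = char_poly A.
Proof.
move=> Ug; have := char_poly_mulC (invmx g *m A) g.
rewrite mulmxA mulmxV // mul1mx => /(mulIf _); apply.
by rewrite -size_poly_eq0 size_polyXn.
Qed.

Lemma char_poly_ublock (F : fieldType) k m (A : 'M[F]_k) (B : 'M_(k, m)) (D : 'M_m) :
  char_poly (block_mx A B 0 D) = char_poly A * char_poly D.
Proof.
rewrite /char_poly /char_poly_mx map_block_mx -[X in X%:M]/('X : {poly F}).
rewrite scalar_mx_block map_mx0 opp_block_mx add_block_mx oppr0 addr0.
by rewrite det_ublock.
Qed.

Lemma full_col_rank_basis (F : fieldType) k m (C : 'M[F]_(k + m, k)) :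
  \rank C = k -> exists2 g : 'M_(k + m), g \in unitmx & C = lsubmx g.
Proof.
move=> rC; pose D := block_mx (row_ebase C) 0 0 (1%:M : 'M_m).
have UD : D \in unitmx.
  by rewrite unitmxE det_ublock det1 mulr1 -unitmxE row_ebase_unit.
exists (col_ebase C *m D); first by rewrite unitmx_mul col_ebase_unit.
rewrite -[LHS]mulmx_ebase rC -mulmx_lsub -mulmxA; congr (_ *m _).
by rewrite /D block_mxEh row_mxKl pid_mx_col mul_col_mx mul1mx mul0mx.
Qed.

Definition conjV_mx (F : fieldType) n (g A : 'M[F]_n) : 'M_n :=
  invmx g *m A *m g.

Fact conjV_mx_is_linear (F : fieldType) n (g : 'M[F]_n) : linear (conjV_mx g).
Proof.
by move=> a A B; rewrite /conjV_mx mulmxDr mulmxDl -scalemxAr -scalemxAl.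
Qed.

HB.instance Definition _ (F : fieldType) n (g : 'M[F]_n) :=
  GRing.isLinear.Build F 'M[F]_n 'M[F]_n _ (conjV_mx g) (conjV_mx_is_linear g).

(* The subspace of [V] stabilizing [P = Im C] maps to the product of the
   actions on [P] and on the quotient by [P], with kernel the matrices having
   image inside [P] and kernel containing [P]. *)
Lemma square_zero_of_dim_gt (F : fieldType) k m tk tm
    (V : {vspace 'M[F]_(k + m)}) (C : 'M[F]_(k + m, k)) :
  weakly_split V ->
  (forall W : {vspace 'M[F]_k}, weakly_split W -> (\dim W <= tk)%N) ->
  (forall W : {vspace 'M[F]_m}, weakly_split W -> (\dim W <= tm)%N) ->
  \rank C = k -> (m * k + tk + tm < \dim V)%N ->
  exists B : 'M[F]_(k, k + m), [/\ B != 0, B *m C = 0 & C *m B \in V].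
Proof.
move=> splitV Hk Hm /full_col_rank_basis[g Ug ->] dimV.
(* In the basis g, [fdl] vanishes on A when A stabilizes P; [ful] and [fdr] then give the actions on
   P and on the quotient. *)
pose fdl : 'Hom('M[F]_(k + m), 'M[F]_(m, k)) :=
  linfun (lsubmx \o (dsubmx \o conjV_mx g)).
pose ful : 'Hom('M[F]_(k + m), 'M[F]_k) := linfun (lsubmx \o (usubmx \o conjV_mx g)).
pose fdr : 'Hom('M[F]_(k + m), 'M[F]_m) := linfun (rsubmx \o (dsubmx \o conjV_mx g)).
pose V1 := (V :&: lker fdl)%VS; pose V2 := (V1 :&: lker ful)%VS.
pose V3 := (V2 :&: lker fdr)%VS.
have conjE A : A \in V1 ->
    conjV_mx g A = block_mx (ful A) (ursubmx (conjV_mx g A)) 0 (fdr A).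
rewrite memv_cap memv_ker lfunE /= => /andP[_ /eqP A0].
  by rewrite !lfunE /= -[LHS]submxK -[dlsubmx _]/(lsubmx (dsubmx _)) A0.
have charV1 A : A \in V1 -> poly_splits (char_poly (ful A) * char_poly (fdr A)).
  move=> AV1; have AV : A \in V by move: AV1; rewrite memv_cap => /andP[].
  rewrite -(char_poly_ublock _ (ursubmx (conjV_mx g A))) -conjE //.
  by rewrite char_poly_conj //; apply: splitV.
have d1 := limg_ker_dim fdl V; have d2 := limg_ker_dim ful V1.
have d3 := limg_ker_dim fdr V2; rewrite -/V1 -/V2 -/V3 in d1 d2 d3.
have b1 : (\dim (fdl @: V) <= m * k)%N.
  by apply: leq_trans (dimvS (subvf _)) _; rewrite dimvf dim_matrix.
have b2 : (\dim (ful @: V1) <= tk)%N.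
  apply: Hk => _ /memv_imgP[A AV1 ->].
  exact: poly_splits_mull (char_poly_monic _) (charV1 A AV1).
have b3 : (\dim (fdr @: V2) <= tm)%N.
  apply: Hm => _ /memv_imgP[A AV2 ->].
  apply: poly_splits_mulr (char_poly_monic _) (charV1 A _).
  by move: AV2; rewrite memv_cap => /andP[].
have V3n0 : V3 != 0%VS.
  rewrite -dimv_eq0; apply: contraTneq dimV => V30.
  rewrite -leqNgt -d1 -d2 -d3 V30 add0n addnC -addnA leq_add //.
  by rewrite addnC leq_add.
pose A := vpick V3; have AV3 : A \in V3 by apply: memv_pick.
have A0 : A != 0 by rewrite vpick0.
move: (AV3); rewrite memv_cap => /andP[AV2 fA3].
move: (AV2); rewrite memv_cap => /andP[AV1 fA2].
move: (AV1); rewrite memv_cap => /andP[AV _].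
have := conjE A AV1; move: fA2 fA3; rewrite !memv_ker => /eqP-> /eqP->.
set U := ursubmx _ => cA.
(* Only the upper right block survives, so A factors through the first k columns of g. *)
have AE : A = lsubmx g *m (row_mx 0 U *m invmx g).
  have -> : A = g *m conjV_mx g A *m invmx g.
    by rewrite /conjV_mx !mulmxA mulmxV // mul1mx mulmxK.
  rewrite cA mulmxA; congr (_ *m _).
  rewrite -{1}[g]hsubmxK mul_row_block !mulmx0 !addr0.
  by rewrite mul_mx_row mulmx0.
exists (row_mx 0 U *m invmx g); split.
- by apply: contraNneq A0 => B0; rewrite AE B0 mulmx0.
- rewrite -mulmxA mulmx_lsub mulVmx // scalar_mx_block block_mxEh row_mxKl.
  by rewrite mul_row_col mul0mx mulmx0 addr0.
- by rewrite -AE.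
Qed.

(** * Counting arcs and grid points *)

(* Otherwise the vertices of large in-degree span no 2-cycle, and counting the
   arcs according to the in-degree of their target gives too few of them. *)
Lemma two_cycle_of_large_degrees (T : finType) (g : rel T) :
  (0 < #|T|)%N -> (forall u, 3 * #|[pred v | ~~ g u v]| <= #|T|)%N ->
  exists u v, [/\ g u v, g v u, (#|T| < 3 * #|[pred w | g w u]|)%N
    & (#|T| < 3 * #|[pred w | g w v]|)%N].
Proof.
move=> T0 outdeg; pose indeg v := #|[pred w | g w v]|.
pose A := [set v | #|T| < 3 * indeg v]%N.
have [/existsP[u /existsP[v /and4P[? ? Hu Hv]]]|no2] :=
    boolP [exists u, exists v, [&& g u v, g v u, u \in A & v \in A]].
  by exists u, v; rewrite !inE in Hu Hv.
have indegE v : indeg v = (\sum_u g u v)%N by rewrite /indeg -sum1_card big_mkcond.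
have split_sum (F : T -> nat) :
    (\sum_v F v = \sum_(v in A) F v + \sum_(v in ~: A) F v)%N.
  rewrite (bigID (mem A)) /=; congr addn.
by apply: eq_bigl => v; rewrite !inE; case: (_ < _)%N.
pose arcs := (\sum_u \sum_v g u v)%N.
have arcs_ge : (2 * #|T| * #|T| <= 3 * arcs)%N.
  rewrite mulnC -sum_nat_const big_distrr /=; apply: leq_sum => u _.
  have <- : #|[pred v | g u v]| = (\sum_v g u v)%N by rewrite -sum1_card big_mkcond.
  have := cardC [pred v | g u v].
  have -> : #|[predC [pred v | g u v]]| = #|[pred v | ~~ g u v]| by apply: eq_card.
  have := outdeg u; move: #|_| #|_| #|_| => a b c; lia.
have arcsE : arcs = (\sum_v indeg v)%N.
  by rewrite /arcs exchange_big; apply: eq_bigr => v _; rewrite indegE.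
have arcs_notA : (3 * \sum_(v in ~: A) indeg v <= #|~: A| * #|T|)%N.
  rewrite big_distrr -sum_nat_const; apply: leq_sum => v.
  by rewrite !inE -leqNgt.
have arcs_A : (\sum_(v in A) indeg v =
   \sum_(v in A) \sum_(u in A) g u v + \sum_(v in A) \sum_(u in ~: A) g u v)%N.
  by rewrite -big_split; apply: eq_bigr => v _; rewrite indegE split_sum.
have arcs_to : (\sum_(v in A) \sum_(u in ~: A) g u v <= #|A| * #|~: A|)%N.
  rewrite -sum_nat_const; apply: leq_sum => v _.
  by rewrite -sum1_card; apply: leq_sum => u _; case: (g u v).
(* Inside A there are no 2-cycles, loops included, so an arc and its reverse never both occur. *)
have arcs_in : (2 * \sum_(v in A) \sum_(u in A) g u v <= #|A| * #|A|)%N.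
  have E : (\sum_(v in A) \sum_(u in A) g u v = \sum_(v in A) \sum_(u in A) g v u)%N.
    exact: exchange_big.
  rewrite mul2n -addnn {2}E -big_split -sum_nat_const.
  apply: leq_sum => v vA; rewrite -big_split -sum1_card.
  apply: leq_sum => u uA /=; move: no2.
  move=> /existsPn/(_ u)/existsPn/(_ v); rewrite uA vA !andbT.
  by case: (g u v); case: (g v u).
have := split_sum indeg; rewrite -arcsE arcs_A.
have := cardsC A; move: T0 arcs_ge arcs_notA arcs_to arcs_in.
(* With N = #|T| and s = #|A|, the bounds combine to (N - s)^2 + s^2 / 2 <= 0, against N > 0. *)
move: #|T| #|A| #|~: A| (arcs) => N s m D.
by nia.
Qed.

Section ProductGrid.

Variables (F : fieldType) (n : nat) (c : 'I_3 -> F).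
Hypothesis inj_c : injective c.

Definition grid_vec (w : {ffun 'I_n -> 'I_3}) : 'cV[F]_n := \col_i c (w i).

(** Where f_i is nonzero, coordinate i of a hyperplane point is determined by the others; changing
    it freely embeds three copies of these points in the grid. *)
Lemma card_grid_hyperplane (f : 'rV[F]_n) : f != 0 ->
  (3 * #|[pred w | pairing f (grid_vec w) == 0%R]| <= #|{ffun 'I_n -> 'I_3}|)%N.
Proof.
move=> /rV0Pn[i fi].
pose Z := [set w | pairing f (grid_vec w) == 0].
pose upd (p : 'I_3 * {ffun 'I_n -> 'I_3}) : {ffun 'I_n -> 'I_3} :=
  [ffun j => if j == i then p.1 else p.2 j].
have upd_inj : {in setX setT Z &, injective upd}.
  move=> [a w] [b w'] /setXP[_ wZ] /setXP[_ w'Z] E.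
  have Ej j : (if j == i then a else w j) = (if j == i then b else w' j).
    by have := congr1 (fun h : {ffun _ -> _} => h j) E; rewrite !ffunE.
  have := Ej i; rewrite eqxx => <-; congr pair; apply/ffunP => j.
  have Eoff k : k != i -> w k = w' k by move=> /negPf ki; have := Ej k; rewrite ki.
  have [->|/Eoff//] := eqVneq j i; apply: inj_c; apply: (mulfI fi).
  move: wZ w'Z; rewrite !inE /pairing !mxE => /eqP wZ /eqP w'Z.
  have Eoff_sum : \sum_(k | k != i) f 0 k * grid_vec w k 0
      = \sum_(k | k != i) f 0 k * grid_vec w' k 0.
    by apply: eq_bigr => k ki; rewrite !mxE Eoff.
  have := etrans wZ (esym w'Z).
  rewrite (bigD1 i) //= [RHS](bigD1 i) //= Eoff_sum.
  by move/addIr; rewrite !mxE.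
have -> : (3 * #|[pred w | pairing f (grid_vec w) == 0%R]|)%N
    = #|setX (setT : {set 'I_3}) Z|.
  by rewrite cardsX cardsT card_ord cardsE.
by rewrite -(card_in_imset upd_inj) max_card.
Qed.

End ProductGrid.

Lemma half_mulnS n : (n * n.+1 %/ 2 * 2 = n * n.+1)%N.
Proof. by apply: divnK; rewrite dvdn2 oddM oddS andbN. Qed.

(** * The inductive upper bound *)

Section UpperBound.

Variables (F : fieldType) (r t : F).
Hypothesis no_root : forall x, x ^+ 2 - r * x + (r ^+ 2 - 1) != 0.
Hypotheses (r0 : r != 0) (r1 : r ^+ 2 != 1) (t0 : t != 0) (t1 : t != 1).
Hypothesis char2 : 2%N \in [pchar F].
Hypothesis squares : forall c : F, exists u, u ^+ 2 = c.

(** Dimension 4 would put the companion matrix of the rootless quadratic in V. *)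
Lemma weakly_split_dim2 (V : {vspace 'M[F]_2}) : weakly_split V -> (\dim V <= 3)%N.
Proof.
move=> splitV; rewrite leqNgt; apply/negP => dimV.
pose q : {poly F} := 'X^2 - r%:P * 'X + (r ^+ 2 - 1)%:P.
have [szq mq] : size q = 3%N /\ q \is monic by exact: size_quadratic.
have [A charA] : exists A : 'M[F]_2, char_poly A = q.
  by have := companionmxK mq; move: (companionmx q); rewrite szq => A; exists A.
have AV : A \in V.
  have -> : V = fullv; last exact: memvf.
  by apply/eqP; rewrite eqEdim subvf dimvf dim_matrix.
have := splitV A AV; rewrite charA.
exact: quadratic_not_split.
Qed.

Lemma weakly_split_dim_step n (V : {vspace 'M[F]_n.+3}) :
  (forall m, (m < n.+3)%N -> forall W : {vspace 'M[F]_m},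
     weakly_split W -> (\dim W <= m * m.+1 %/ 2)%N) ->
  weakly_split V -> (\dim V <= n.+3 * n.+4 %/ 2)%N.
Proof.
move=> IH splitV; rewrite leqNgt; apply/negP => dimV.
(* For lines the threshold (n+2) + 1 + (n+2)(n+3)/2 is exactly (n+3)(n+4)/2; for planes so is 2(n+1)
   + 3 + (n+1)(n+2)/2. *)
have line (x : 'cV[F]_n.+3) : x != 0 -> exists f, rank_one_nilpotent V x f /\ f != 0.
  move=> x0.
  have rx : \rank (x : 'M_(1 + n.+2, 1)) = 1%N.
    by rewrite -mxrank_tr rank_rV trmx_eq0 x0.
  have [||||B [B0 Bx xB]] :=
    @square_zero_of_dim_gt F 1 n.+2 1 (n.+2 * n.+3 %/ 2) V x splitV.
  - by move=> W /IH; apply.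
  - by move=> W /IH; apply.
  - by [].
  - apply: leq_ltn_trans dimV; have := half_mulnS n.+2; have := half_mulnS n.+3; nia.
  by exists B; split=> //; split=> //; rewrite /pairing Bx mxE.
have plane (x y : 'cV[F]_n.+3) (f g : 'rV_n.+3) :
    pairing f x = 0 -> pairing f y = 1 -> pairing g y = 0 -> pairing g x = 1 ->
  exists u v, [/\ x *m u + y *m v \in V,
      [/\ pairing u x = 0, pairing u y = 0, pairing v x = 0 & pairing v y = 0]
    & u != 0 \/ v != 0].
  move=> fx fy gy gx; pose C : 'M_(2 + n.+1, 1 + 1) := row_mx x y.
  have pE (h : 'rV_n.+3) z : h *m z = (pairing h z)%:M by exact: mx11_scalar.
  have rC : \rank C = 2.
    apply/eqP; rewrite eqn_leq rank_leq_col.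
    rewrite -[X in (X <= _)%N](mxrank1 F (1 + 1)).
    have <- : col_mx g f *m C = 1%:M.
      by rewrite /C mul_col_row !pE fx fy gx gy scalar_mx_block !raddf0.
    exact: mxrankM_maxr.
  have [||||B [B0 BC CB]] :=
    @square_zero_of_dim_gt F 2 n.+1 3 (n.+1 * n.+2 %/ 2) V C splitV.
  - by move=> W /IH; apply.
  - by move=> W /IH; apply.
  - by [].
  - apply: leq_ltn_trans dimV; have := half_mulnS n.+1; have := half_mulnS n.+3; nia.
  move: BC CB B0; rewrite -[B](@vsubmxK _ 1 1) /C; set u := usubmx _; set v := dsubmx _.
  move=> BC CB B0; have inV : x *m u + y *m v \in V.
    by rewrite -(mul_row_col x y u v).
  have := etrans (esym (mul_col_row u v x y)) BC.
  rewrite -[X in _ = X -> _](@block_mx0 F 1 1 1 1) => /eq_block_mx[ux uy vx vy].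
  exists u, v; split=> //; first by split; rewrite /pairing ?ux ?uy ?vx ?vy mxE.
  apply/orP; rewrite -negb_and; apply: contraNN B0 => /andP[/eqP-> /eqP->].
  by rewrite col_mx0.
(* The grid values 1, t, 1 + t are nonzero, so every grid vector is nonzero. *)
have [c [inj_c c0]] : exists c : 'I_3 -> F, injective c /\ forall i, c i != 0.
  pose vals := [:: 1; t; 1 + t].
  have t10 : 1 + t != 0 by rewrite addr_eq0 (oppr_pchar2 char2) eq_sym.
  have uniq_vals : uniq vals.
    have ne1 : 1 != 1 + t by rewrite -subr_eq0 opprD addrA subrr add0r oppr_eq0.
    have net : t != 1 + t by rewrite eq_sym -subr_eq0 addrK oner_eq0.
    by rewrite /= !inE negb_or eq_sym t1 ne1 net.
  exists (fun i : 'I_3 => vals`_i); split=> [i j /eqP|].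
    by rewrite nth_uniq // => /eqP/val_inj.
  by case=> [[|[|[|]]]] //= _; rewrite ?oner_eq0.
have gridP w : exists f, rank_one_nilpotent V (grid_vec c w) f /\ f != 0.
  apply: line; apply: contraTneq (c0 (w ord0)) => /matrixP/(_ ord0 0).
  by rewrite !mxE => ->; rewrite eqxx.
have [f Rf] := fin_all_exists gridP.
pose g u v := pairing (f u) (grid_vec c v) != 0.
have [||u [v [uv vu degu degv]]] := @two_cycle_of_large_degrees _ g.
- by apply/card_gt0P; exists [ffun=> ord0].
- move=> u; rewrite (eq_card (B := [pred w | pairing (f u) (grid_vec c w) == 0%R])).
    by apply: card_grid_hyperplane => //; case: (Rf u).
  by move=> w; rewrite !inE negbK.
have normal a b : g a b -> exists2 h, rank_one_nilpotent V (grid_vec c a) h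
    & pairing h (grid_vec c b) = 1.
  move=> ab; have [[inV fa] _] := Rf a.
  exists ((pairing (f a) (grid_vec c b))^-1 *: f a).
  - by split; rewrite ?pairingZ ?fa ?mulr0 // -scalemxAr rpredZ.
  - by rewrite pairingZ mulVf.
have [h Rh hv] := normal u v uv; have [k Rk ku] := normal v u vu.
(* Every w with an arc to a lies in the kernel of d, which bounds the in-degree of a. *)
have degree_lt a (d : 'rV_n.+3) : d != 0 ->
    (forall w, pairing (f w) (grid_vec c a) * pairing d (grid_vec c w) = 0) ->
    (3 * #|[pred w | g w a]| <= #|{ffun 'I_n.+3 -> 'I_3}|)%N.
  move=> d0 H; apply: leq_trans (card_grid_hyperplane inj_c d0).
  rewrite leq_mul2l; apply/subset_leq_card/subsetP => w; rewrite !inE => wa.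
  by have /eqP := H w; rewrite mulf_eq0 (negPf wa).
(* A nonzero [be] bounds the in-degree of v, and by symmetry a nonzero [ga] that of u; both degrees
   are too large for this. *)
have [be [ga [inV [bu bv gu gv] []]]] := plane _ _ _ _ Rh.2 hv Rk.2 ku.
- move=> b0; have := degree_lt v be b0; rewrite leqNgt degv => H.
  suff: false by []. apply: H => w.
  exact: (plane_identity no_root splitV t0 t1 squares r0 r1 Rh Rk (Rf w).1 hv ku inV).
- move=> b0; have := degree_lt u ga b0; rewrite leqNgt degu => H.
  suff: false by []. apply: H => w; rewrite addrC in inV.
  exact: (plane_identity no_root splitV t0 t1 squares r0 r1 Rk Rh (Rf w).1 ku hv inV).
Qed.

End UpperBound.

Lemma weakly_split_dim (F : fieldType) (r t : F) :
  2%N \in [pchar F] -> (forall c : F, exists u, u ^+ 2 = c) ->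
  t != 0 -> t != 1 -> r != 0 -> r ^+ 2 != 1 ->
  (forall x, x ^+ 2 - r * x + (r ^+ 2 - 1) != 0) ->
  forall n (V : {vspace 'M[F]_n}), weakly_split V ->
  (\dim V <= n * n.+1 %/ 2)%N.
Proof.
move=> char2 squares t0 t1 r0 r1 no_root; elim/ltn_ind => n IH V splitV.
have dim_le : (\dim V <= n * n)%N.
  by have := dimvS (subvf V); rewrite dimvf dim_matrix.
(* For n <= 1 the ambient dimension n^2 already equals the bound. *)
case: n => [|[|[|n]]] in V splitV dim_le IH *; do ?exact: dim_le.
  exact: weakly_split_dim2 no_root _ splitV.
exact: (weakly_split_dim_step no_root r0 r1 t0 t1 char2 squares (n := n) (V := V)).
Qed.

(** * Triangularizable matrices and the extremal space *)

Lemma triangularizable_splits (F : fieldType) n (A : 'M[F]_n) :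
  triangularizable A -> poly_splits (char_poly A).
Proof.
move=> [P UP]; rewrite /similar_to => trigA; set T := conjmx P A in trigA.
have <- : char_poly T = char_poly A.
  by rewrite /T conjumx // -{1}[P]invmxK char_poly_conj ?unitmx_inv.
have -> : char_poly T = char_poly T^T.
  rewrite /char_poly -det_tr; congr (\det _).
  by rewrite /char_poly_mx linearB /= tr_scalar_mx map_trmx.
rewrite char_poly_trig //.
exists [seq T^T i i | i <- enum 'I_n].
by rewrite big_map big_enum.
Qed.

(** Its kernel is the space of upper-triangular matrices, which attains the bound. *)
Definition strict_lower (F : fieldType) n (A : 'M[F]_n) : 'M_n :=
  \matrix_(i, j) if (j < i)%N then A i j else 0.

Fact strict_lower_is_linear (F : fieldType) n : linear (@strict_lower F n).
Proof.
move=> a A B; apply/matrixP => i j; rewrite !mxE.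
by case: ifP; rewrite ?mulr0 ?addr0.
Qed.

HB.instance Definition _ (F : fieldType) n :=
  GRing.isLinear.Build F 'M[F]_n 'M[F]_n _ (@strict_lower F n)
    (@strict_lower_is_linear F n).

Lemma dim_strict_lower (F : fieldType) n :
  (\dim (limg (linfun (@strict_lower F n))) <= 'C(n, 2))%N.
Proof.
pose X := [seq delta_mx i j : 'M[F]_n | i <- enum 'I_n,
                        j <- [seq j : 'I_n <- enum 'I_n | (j < i)%N]].
have sX : size X = 'C(n, 2).
  rewrite size_allpairs_dep -bin2_sum sumnE big_map.
  rewrite big_enum big_mkord /=; apply: eq_bigr => i _.
  rewrite size_filter -sum1_count big_enum_cond /=.
  rewrite (big_ord_narrow (ltnW (ltn_ord i))) sum_nat_const card_ord.
  exact: muln1.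
rewrite -sX; apply: leq_trans (dim_span _); apply: dimvS.
apply/subvP => _ /memv_imgP[A _ ->]; rewrite lfunE /= [strict_lower A]matrix_sum_delta.
rewrite memv_suml // => i _; rewrite memv_suml // => j _; rewrite mxE.
have [ji|_] := ifP; last by rewrite scale0r mem0v.
rewrite memvZ // memv_span //; apply: allpairs_f_dep; first by rewrite mem_enum.
by rewrite mem_filter ji mem_enum.
Qed.

Theorem theorem1p3 (F : fieldType) (n : nat)
    (hchar : 2%N \in [pchar F])
    (hperf : perfect_field F)
    (hquad : ~ quadratically_closed F)
    (hcard : exists s : seq F, uniq s && (2 < size s)%N)
    (hn : (1 <= n)%N) :
  (exists V : {vspace 'M[F]_n},
     weakly_triangularizable V /\ \dim V = (n * n.+1 %/ 2)%N) /\
  (forall V : {vspace 'M[F]_n},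
     weakly_triangularizable V -> (\dim V <= n * n.+1 %/ 2)%N).
Proof.
have [t t0 t1] : exists2 t : F, t != 0 & t != 1.
  have [s /andP[us ss]] := hcard.
  have : ~~ all [in [:: 0; 1 : F]] s.
    by apply: contraL ss => /allP/(uniq_leq_size us); rewrite -leqNgt.
  by case/allPn => t _; rewrite !inE negb_or => /andP[]; exists t.
have [r [r0 r1 no_root]] := rootless_quadratic hchar hperf hquad t0 t1.
have ub (V : {vspace 'M[F]_n}) :
    weakly_triangularizable V -> (\dim V <= n * n.+1 %/ 2)%N.
  move=> trigV; apply: (weakly_split_dim hchar _ t0 t1 r0 r1 no_root).
    exact: perfect_pchar2_sqrt.
  by move=> A /trigV/triangularizable_splits.
split=> //; pose V := lker (linfun (@strict_lower F n)).
have trigV : weakly_triangularizable V.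
  move=> A; rewrite memv_ker lfunE /= => /eqP/matrixP A0.
  exists 1%:M; first exact: unitmx1.
  rewrite /similar_to conj1mx; apply/is_trig_mxP => i j ij.
  by have := A0 j i; rewrite !mxE ij.
exists V; split=> //; apply/eqP; rewrite eqn_leq ub //=.
(* Rank-nullity gives dim V >= n^2 - n(n-1)/2 = n(n+1)/2. *)
have := limg_ker_dim (linfun (@strict_lower F n)) fullv.
rewrite capfv -/V dimvf dim_matrix.
have binE : ('C(n, 2) * 2 = n * n.-1)%N.
  by case: (n) hn => // m _; rewrite bin2 -divn2 /= (mulnC m.+1) half_mulnS.
have := dim_strict_lower F n; have := half_mulnS n.
move: (\dim _) (\dim _) => a b; nia.
Qed.
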